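(* Let $f:\mathbb R^2\to\mathbb C$ be a source function with compact support $\Omega$ such that $(f,\Omega)$ satisfies the source assumption stated in the context. For any fixed observation direction $\hat x\in\mathbb S^1$, if the derivative of the function $I_{\hat x}:\mathbb R\to\mathbb C$ does not exist at $s_0\in\mathbb R$, then the line $l_{\hat x,s_0}=\{y\in\mathbb R^2 : \hat x\cdot y=s_0\}$ must pass through some point of $X(\partial\Omega)\cup Y_{\hat x}(\partial\Omega)$.
   Context: Notation. $\mathbb S^1=\{x\in\mathbb R^2:|x|=1\}$; for $\hat x\in\mathbb S^1$, $\hat x^\perp$ is $\hat x$ rotated anticlockwise by $\pi/2$; for $s\in\mathbb R$, $l_{\hat x,s}:=\{y\in\mathbb R^2:\hat x\cdot y=s\}$. Source assumption on $(f,\Omega)$, where $\Omega=\operatorname{supp} f$ is compact: (i) $\Omega=\bigcup_{m=1}^M\Omega_m$ where the $\Omega_m$ are compact and pairwise disjoint; each boundary $\partial\Omega_m$ is piecewise $C^1$ with finitely many corners, and the interior of each $\Omega_m$ is a connected domain ($\Omega_m$ need not be simply connected). (ii) For any $\hat x\in\mathbb S^1$ and any $s\in\mathbb R$ there exist $J(s)<\infty$ and numbers $\alpha_j(s),\beta_j(s)$ with $\beta_j(s)\le\alpha_j(s)$ for $j=1,\dots,J(s)$, $\alpha_j(s)\le\beta_{j+1}(s)$ for $j=1,\dots,J(s)-1$, and $l_{\hat x,s}\cap\Omega=\bigcup_{j=1}^{J(s)}\{s\hat x+\tau\hat x^\perp:\beta_j(s)\le\tau\le\alpha_j(s)\}$.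 (iii) $f|_{\Omega_m}\in C^1(\Omega_m)$ for $m=1,\dots,M$, and $f(y)\ne0$ for all $y\in\partial\Omega$. Far field pattern: $u^\infty(\hat x,k)=\int_{\mathbb R^2}e^{-ik\hat x\cdot y}f(y)\,dy$, for $\hat x\in\mathbb S^1$ and $k\in\mathbb R$ (this is the far field pattern of the radiating solution of $\Delta u+k^2u=-f$ for $k>0$, extended by $u^\infty(\hat x,0)=\lim_{k\to0}u^\infty(\hat x,k)$ and $u^\infty(\hat x,k)=u^\infty(-\hat x,-k)$ for $k<0$). The function $I_{\hat x}$ is $I_{\hat x}(s)=\int_{-\infty}^{+\infty}f(s\hat x+\tau\hat x^\perp)\,d\tau$, $s\in\mathbb R$. By Fourier inversion it is obtained from the multi-frequency far field patterns at the two directions $\pm\hat x$, since (up to a constant factor) it equals $\int_{-\infty}^{\infty}u^\infty(\hat x,k)e^{iks}\,dk=\int_0^\infty[u^\infty(\hat x,k)e^{iks}+u^\infty(-\hat x,k)e^{-iks}]\,dk$. $X(\partial\Omega)\subset\partial\Omega$ is the set of all corners of $\partial\Omega$, where $y\in\partial\Omega$ is a corner if the unit normal $\nu$ to $\partial\Omega$ is not continuous at $y$. $Y_{\hat x}(\partial\Omega)\subset\partial\Omega$ is the set of all points of $\partial\Omega$ whose normal direction is parallel to $\hat x$. *)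

(* Defs.v *)
From HB Require Import structures.
From mathcomp Require Import all_boot all_order all_algebra complex.
From mathcomp Require Import all_classical all_reals all_analysis.

Set Implicit Arguments.
Unset Strict Implicit.
Unset Printing Implicit Defensive.

Import Order.TTheory GRing.Theory Num.Theory.
Import numFieldNormedType.Exports.

Local Open Scope classical_set_scope.
Local Open Scope ring_scope.
Local Open Scope complex_scope.

Section Plane.
Context {R : realType}.
Implicit Types (x y n : R * R) (A : set (R * R)).

Definition dot x y : R := x.1 * y.1 + x.2 * y.2.

(* [`|x|] is the sup norm on [R * R], hence the use of [dot] here. *)
Definition unit_circle : set (R * R) := [set x | dot x x = 1].

Definition perp x : R * R := (- x.2, x.1).

Definition line x (s : R) : set (R * R) := [set y | dot x y = s].

Definition boundary A : set (R * R) := closure A `\` interior A.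

(* [n] is the exterior unit normal to the boundary of [A] at [y]: it is
   orthogonal to the boundary to first order at [y], and points out of [A].
   No such [n] exists at a cusp, for instance. *)
Definition unit_normal A y n : Prop :=
  [/\ dot n n = 1,
      forall e : R, 0 < e ->
        \forall z \near y, boundary A z -> `|dot n (z - y)| <= e * `|z - y| &
      \forall t \near (0 : R)^'+, A (y - t *: n) /\ ~ A (y + t *: n)].

Definition normal_continuous_at A y : Prop :=
  exists nu : R * R -> R * R,
    (\forall z \near y, boundary A z -> unit_normal A z (nu z)) /\
    nu z @[z --> within (boundary A) (nbhs y)] --> nu y.

Definition corners A : set (R * R) :=
  [set y | boundary A y /\ ~ normal_continuous_at A y].

Definition normal_parallel_points x A : set (R * R) :=
  [set y | boundary A y /\
     exists n, unit_normal A y n /\ exists c : R, n = c *: x].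

(* A regular simple C^1 arc parametrised by [0, 1]; as a C^1 function on [0, 1]
   extends to a C^1 function on the line, [g] is taken to be C^1 on [R]. *)
Definition C1_arc (g : R -> R * R) : Prop :=
  [/\ forall t, derivable g t 1,
      continuous (g^`())%classic,
      forall t, t \in `[0, 1] -> (g^`())%classic t != 0 &
      {in `[0, 1] &, injective g}].

Definition piecewise_C1 A : Prop :=
  exists (N : nat) (g : 'I_N -> R -> R * R),
    [/\ forall i, C1_arc (g i),
        forall i j, i != j -> g i @` `]0, 1[ `&` g j @` `[0, 1] = set0 &
        A = \bigcup_(i in [set: 'I_N]) (g i @` `[0, 1])].

(* C^1 up to the boundary: the partial derivatives in the interior of [K]
   extend continuously to [K]. *)
Definition C1_on (K : set (R * R)) (h : R * R -> R) : Prop :=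
  {within K, continuous h} /\
  exists h1 h2 : R * R -> R,
    [/\ {within K, continuous h1}, {within K, continuous h2} &
        forall y, interior K y ->
          is_derive y (1, 0) h (h1 y) /\ is_derive y (0, 1) h (h2 y)].

Definition supp (f : R * R -> R[i]) : set (R * R) :=
  closure [set y | f y != 0].

Definition source_components (f : R * R -> R[i]) (Omega : set (R * R)) : Prop :=
  exists (M : nat) (Om : 'I_M -> set (R * R)),
    [/\ Omega = \bigcup_(m in [set: 'I_M]) Om m,
        trivIset [set: 'I_M] Om,
        forall m, [/\ compact (Om m),
                      piecewise_C1 (boundary (Om m)),
                      finite_set (corners (Om m)),
                      interior (Om m) !=set0 &
                      connected (interior (Om m))] &
        forall m, C1_on (Om m) (fun y => complex.Re (f y)) /\
                  C1_on (Om m) (fun y => complex.Im (f y))].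

(* [J = 0] is the case of a line that misses [Omega]. *)
Definition line_sections (Omega : set (R * R)) : Prop :=
  forall x, unit_circle x -> forall s : R,
    exists (J : nat) (alpha beta : nat -> R),
      [/\ forall j, (j < J)%N -> beta j <= alpha j,
          forall j, (j.+1 < J)%N -> alpha j <= beta j.+1 &
          line x s `&` Omega =
          \bigcup_(j in [set j | (j < J)%N])
            [set s *: x + tau *: perp x | tau in `[beta j, alpha j]]].

Definition source_assumption (f : R * R -> R[i]) (Omega : set (R * R)) : Prop :=
  [/\ source_components f Omega,
      line_sections Omega &
      forall y, boundary Omega y -> f y != 0].

Definition cRintegral (g : R -> R[i]) : R[i] :=
  (\int[lebesgue_measure]_t complex.Re (g t))%R +i*
  (\int[lebesgue_measure]_t complex.Im (g t))%R.

Definition line_integral (f : R * R -> R[i]) x (s : R) : R[i] :=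
  cRintegral (fun tau => f (s *: x + tau *: perp x)).

(* [R[i]] is not a normed module over [R] in the library, so that [derivable]
   does not apply to functions from [R] to [R[i]]. *)
Definition complex_derivable (F : R -> R[i]) (s : R) : Prop :=
  cvg ((fun h : R => (h%:C)^-1 * (F (s + h) - F s) : R[i]^o) @ (0 : R)^').

End Plane.

(* Main.v *)
(* Use coordinates y = s x + t x^perp.  At a boundary point that is neither a
   corner nor has a normal parallel to x, the boundary is squeezed between two
   lines t = (p +- e) s for every e > 0, so each of the two complementary
   (convex) cones lies either inside Omega or outside it.  Hence f has one-sided
   limits c-, c+ and one-sided x-derivatives d-, d+ across the boundary, and for
   a < t0 < b close to t0 the difference quotient of \int_a^b f(s, t) dt at s0
   is asymptotically within eta (b - a) of
   p (c- - c+) + d- (t0 - a) + d+ (b - t0).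
   Points of the line off the boundary are the case c- = c+, d- = d+.  Chaining
   such intervals across the support shows that, for every eta, the difference
   quotients of the full integral are eventually within eta of a constant: they
   are Cauchy. *)
Require Import Defs.
From mathcomp Require Import all_boot all_order all_algebra complex.
From mathcomp Require Import all_classical all_reals all_analysis.
From mathcomp Require Import measurable_realfun lra.

Set Implicit Arguments.
Unset Strict Implicit.

Import Order.TTheory GRing.Theory Num.Theory.
Import numFieldNormedType.Exports.

Local Open Scope classical_set_scope.
Local Open Scope ring_scope.
Local Open Scope complex_scope.

(** * Chaining a local relation along a segment *)

(* The hypothesis is for t strictly inside ]a, b[: an integral over an interval
   that ends on the boundary of Omega may only be one-sided differentiable. *)
Lemma chain_across (R : realType) (P : R -> R -> Prop) :
  (forall a b c, P a b -> P b c -> P a c) ->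
  (forall t, exists2 e, 0 < e &
     forall a b, t - e < a -> a < t -> t < b -> b < t + e -> P a b) ->
  forall A B, A <= B -> exists a b, [/\ A - 1 < a < A, B < b < B + 1 & P a b].
Proof.
move=> trP locP' A B AB.
(* Capping the radius at 1 keeps the starting point [a0] above [A - 1] and, below, [sup T + r]
   within [B + 1]. *)
have locP t : exists e, [/\ 0 < e, e <= 1 &
    forall a b, t - e < a -> a < t -> t < b -> b < t + e -> P a b].
  have [e e0 Pe] := locP' t; exists (Num.min e 1).
  rewrite lt_min e0 ltr01 ge_min lexx orbT; split=> // a b ea at_ tb be.
  have ? : Num.min e 1 <= e by rewrite ge_min lexx.
  by apply: Pe => //; lra.
have [e [e0 e1 Pe]] := locP A.
apply: contrapT => noP; pose a0 := A - e / 2.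
have noB b : B < b -> b < B + 1 -> ~ P a0 b.
  move=> Bb bB Pab; apply: noP; exists a0, b.
  by split => //; rewrite /a0; apply/andP; split; lra.
(* Supremum argument: [T] holds the levels that chains from [a0] approach from below. The cap
   [B + 1] lets [noB] exclude levels beyond [B]. As the ends [b] stay strictly below their level,
   some chain stops just below [sup T], and the local hypothesis at [sup T] carries it across, which
   is absurd. *)
pose T := [set t | t <= B + 1 /\
  forall u, u < t -> exists b, [/\ u < b, b < t & P a0 b]].
have TA : T (A + e).
  split=> [|u ue]; first lra.
  exists ((Num.max u A + (A + e)) / 2).
  have ? : u <= Num.max u A by rewrite le_max lexx.
  have ? : A <= Num.max u A by rewrite le_max lexx orbT.
  have ? : Num.max u A < A + e by rewrite gt_max ue; lra.
  by split; [lra|lra|apply: Pe; rewrite /a0; lra].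
have ubT : ubound T B.
  move=> t [tB Tt]; rewrite leNgt; apply/negP => Bt.
  by have [b [Bb bt /(noB _ Bb (lt_le_trans bt tB))]] := Tt _ Bt.
have supT : has_sup T by split; [exists (A + e) | exists B].
have [r [r0 r1 Pr]] := locP (sup T).
have [t [tB Tt] ltt] := sup_adherent r0 supT.
have tT : t <= sup T by apply: ub_le_sup => //; exists B.
have [b [rb bt Pb]] := Tt _ ltt.
have sB : sup T <= B by apply: ge_sup => //; case: supT.
have : T (sup T + r).
  split=> [|u ue]; first lra.
  exists ((Num.max u (sup T) + (sup T + r)) / 2).
  have ? : u <= Num.max u (sup T) by rewrite le_max lexx.
  have ? : sup T <= Num.max u (sup T) by rewrite le_max lexx orbT.
  have ? : Num.max u (sup T) < sup T + r by rewrite gt_max ue; lra.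
  by split; [lra|lra|apply: trP Pb _; apply: Pr; lra].
move=> /(ub_le_sup (ex_intro _ B ubT)); lra.
Qed.

(** * Integrals of bounded measurable functions over compact intervals *)

Section interval_integral.
Context {R : realType}.
Implicit Types (g : R -> R) (a b c : R).

Definition bounded_measurable g :=
  measurable_fun [set: R] g /\ exists M, forall t, `|g t| <= M.

Definition itv_integral g a b : R :=
  \int[@lebesgue_measure R]_(t in `[a, b]) g t.

Lemma bounded_measurable_integrable g a b : bounded_measurable g ->
  (@lebesgue_measure R).-integrable `[a, b] (EFin \o g).
Proof.
move=> [mg [M gM]]; apply: measurable_bounded_integrable => //.
- rewrite /= lebesgue_measure_itv /=; case: ifP => // _.
  by rewrite -EFinB ltry.
- exact: measurable_funTS.
- exists M; split; first exact: num_real.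
  by move=> y My t _; apply: le_trans (gM t) (ltW My).
Qed.

Lemma bounded_measurableB g1 g2 : bounded_measurable g1 ->
  bounded_measurable g2 -> bounded_measurable (fun t => g1 t - g2 t).
Proof.
move=> [m1 [M1 h1]] [m2 [M2 h2]]; split; first exact: measurable_funB.
by exists (M1 + M2) => t; rewrite (le_trans (ler_normB _ _))// lerD.
Qed.

Lemma itv_integral_cat g a b c : bounded_measurable g -> a <= b -> b <= c ->
  itv_integral g a c = itv_integral g a b + itv_integral g b c.
Proof.
move=> bg ab bc; rewrite /itv_integral.
have := @Rintegral_itvB R g (BLeft a) (BRight c) b
  (bounded_measurable_integrable a c bg).
rewrite !bnd_simp => /(_ ab bc).
rewrite Rintegral_itv_obnd_cbnd; first by move=> <-; rewrite addrC subrK.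
apply: integrableS (bounded_measurable_integrable b c bg) => //=.
by apply: subset_itv; rewrite bnd_simp.
Qed.

Lemma itv_integralB g1 g2 a b : bounded_measurable g1 ->
  bounded_measurable g2 ->
  itv_integral (fun t => g1 t - g2 t) a b =
  itv_integral g1 a b - itv_integral g2 a b.
Proof.
by move=> b1 b2; apply: RintegralB => //; exact: bounded_measurable_integrable.
Qed.

(** The endpoints form a null set, so bounds on the open interval suffice; this suits the strict
    inequalities that define the cones of [jump_at]. *)
Lemma itv_integral_near_cst g a b (c e : R) : bounded_measurable g -> a <= b ->
  (forall t, a < t -> t < b -> `|g t - c| <= e) ->
  `|itv_integral g a b - c * (b - a)| <= e * (b - a).
Proof.
move=> bg; rewrite le_eqVlt => /predU1P[<- _|ab gc].
  by rewrite /itv_integral set_itv1 Rintegral_set1 subrr !mulr0 subrr normr0.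
have igo : (@lebesgue_measure R).-integrable `]a, b[ (EFin \o g).
  apply: integrableS (bounded_measurable_integrable a b bg) => //=.
  exact: subset_itv_oo_cc.
have igl : (@lebesgue_measure R).-integrable `]a, b] (EFin \o g).
  apply: integrableS (bounded_measurable_integrable a b bg) => //=.
  exact: subset_itv_oc_cc.
have ->: itv_integral g a b = \int[@lebesgue_measure R]_(t in `]a, b[) g t.
  by rewrite /itv_integral -Rintegral_itv_obnd_cbnd// -Rintegral_itv_bndo_bndc.
have icst r : (@lebesgue_measure R).-integrable `]a, b[ (EFin \o cst r).
  have bm : bounded_measurable (cst r) by split => //; exists `|r|.
  apply: integrableS (bounded_measurable_integrable a b bm) => //=.
  exact: subset_itv_oo_cc.
have Icst r : \int[@lebesgue_measure R]_(t in `]a, b[) (cst r t) = r * (b - a).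
  rewrite Rintegral_cst//= lebesgue_measure_itv/= lte_fin ab -EFinB//.
have up : \int[@lebesgue_measure R]_(t in `]a, b[) g t <= (c + e) * (b - a).
  rewrite -Icst; apply: le_Rintegral => //= t; rewrite in_itv/= => /andP[at_ tb].
  by have := gc _ at_ tb; rewrite ler_distl => /andP[].
have lo : (c - e) * (b - a) <= \int[@lebesgue_measure R]_(t in `]a, b[) g t.
  rewrite -Icst; apply: le_Rintegral => //= t; rewrite in_itv/= => /andP[at_ tb].
  by have := gc _ at_ tb; rewrite ler_distl => /andP[].
rewrite ler_distl; move: (\int[_]_(_ in _) _) lo up => I lo up.
by apply/andP; split; lra.
Qed.

End interval_integral.

(** The window is cut at [q - rho] and [q + rho]: the outer pieces are nearly constant, and on the
    middle piece only the bound [M] is available. In the application [q = p * h] is where the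
    boundary has moved to, and [rho] is the half-width of the cone there. *)
Lemma itv_integral_step (R : realType) (g : R -> R) (M t0 q rho r cm cp e : R) :
  bounded_measurable g -> (forall t, `|g t| <= M) -> 0 < e ->
  0 <= rho -> - r <= q - rho -> q + rho <= r ->
  (forall k, - r < k -> k < q - rho -> `|g (t0 + k) - cm| <= e) ->
  (forall k, q + rho < k -> k < r -> `|g (t0 + k) - cp| <= e) ->
  `|itv_integral g (t0 - r) (t0 + r) - (cm * (q + r) + cp * (r - q))| <=
    2 * e * r + (2 * M + `|cm| + `|cp|) * rho.
Proof.
move=> bg gM e0 rho0 rq qr gm gp.
have t01 : t0 - r <= t0 + q - rho by clear -rq; lra.
have t12 : t0 + q - rho <= t0 + q + rho by clear -rho0; lra.
have t23 : t0 + q + rho <= t0 + r by clear -qr; lra.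
rewrite (itv_integral_cat bg t01 (le_trans t12 t23)).
rewrite (itv_integral_cat bg t12 t23).
have I1 : `|itv_integral g (t0 - r) (t0 + q - rho) -
    cm * (t0 + q - rho - (t0 - r))| <= e * (t0 + q - rho - (t0 - r)).
  apply: itv_integral_near_cst => // t t1 t2.
  have -> : t = t0 + (t - t0) by rewrite addrC subrK.
  by apply: gm; clear -t1 t2; lra.
have I2 : `|itv_integral g (t0 + q - rho) (t0 + q + rho) -
    0 * (t0 + q + rho - (t0 + q - rho))| <=
    M * (t0 + q + rho - (t0 + q - rho)).
  by apply: itv_integral_near_cst => // t _ _; rewrite subr0.
have I3 : `|itv_integral g (t0 + q + rho) (t0 + r) -
    cp * (t0 + r - (t0 + q + rho))| <= e * (t0 + r - (t0 + q + rho)).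
  apply: itv_integral_near_cst => // t t1 t2.
  have -> : t = t0 + (t - t0) by rewrite addrC subrK.
  by apply: gp; clear -t1 t2; lra.
have crho (z : R) : `|z * rho| = `|z| * rho by rewrite normrM (ger0_norm rho0).
have : - (`|cm| * rho) <= cm * rho <= `|cm| * rho by rewrite -ler_norml crho.
have : - (`|cp| * rho) <= cp * rho <= `|cp| * rho by rewrite -ler_norml crho.
have : 0 <= e * rho by rewrite mulr_ge0// ltW.
clear -I1 I2 I3; move: I1 I2 I3; rewrite !ler_norml.
do 3 move: (itv_integral _ _ _) => ?.
move=> /andP[? ?] /andP[? ?] /andP[? ?] ? /andP[? ?] /andP[? ?].
by apply/andP; split; lra.
Qed.

(** [A], [B], [C] stand for the integrals below, inside and above the window of half-width [r] at
    [s0 + h], and the primed letters for those at [s0]. Extending the slopes [dm] and [dp] over the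
    window up to [t0] costs at most [(|dm| + |dp|) * r * |h|]. *)
Lemma sum_near_linear (R : realType)
    (A A' B B' C C' a b t0 h r D dm dp q eta : R) :
  0 <= eta -> 0 <= r -> a <= b ->
  `|A - A' - dm * h * (t0 - r - a)| <= eta / 4 * `|h| * (t0 - r - a) ->
  `|C - C' - dp * h * (b - (t0 + r))| <= eta / 4 * `|h| * (b - (t0 + r)) ->
  `|B - B' - D * h| <= eta / 4 * (b - a) * `|h| ->
  (`|dm| + `|dp|) * r <= eta / 4 * (b - a) ->
  `|A + (B + C) - (A' + (B' + C')) -
     (D + dm * (t0 - a) + dp * (b - t0)) * h| <= eta * (b - a) * `|h|.
Proof.
move=> eta0 r0 ab IA IC IB dr.
have H0 : 0 <= `|h| by [].
have dhr (z : R) : `|z * h * r| = `|z| * `|h| * r.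
  by rewrite !normrM (ger0_norm r0).
have : - (`|dm| * `|h| * r) <= dm * h * r <= `|dm| * `|h| * r.
  by rewrite -ler_norml dhr.
have : - (`|dp| * `|h| * r) <= dp * h * r <= `|dp| * `|h| * r.
  by rewrite -ler_norml dhr.
have := ler_wpM2r H0 dr.
have : 0 <= eta * `|h| * r by rewrite !mulr_ge0.
have : 0 <= eta * `|h| * (b - a) by rewrite !mulr_ge0// subr_ge0.
move: (`|h|) IA IC IB => H; clear; rewrite !ler_norml.
move=> /andP[? ?] /andP[? ?] /andP[? ?] ? ? ? /andP[? ?] /andP[? ?].
by apply/andP; split; lra.
Qed.

(** * Difference quotients of the integral across a jump *)

Section jump.
Context {R : realType}.
Variables (F : R -> R -> R) (M : R).
Hypotheses (mF : forall s, measurable_fun [set: R] (F s))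
  (FM : forall s t, `|F s t| <= M).

(* Outside the cone of slopes [p - e, p + e] at (s0, t0), F is close to cm
   below and to cp above; dm and dp approximate its s-derivative. *)
Definition jump_at s0 t0 (p cm cp dm dp : R) :=
  forall e, 0 < e -> exists2 d, 0 < d & forall h k, `|h| < d -> `|k| < d ->
  [/\ k < p * h - e * `|h| -> `|F (s0 + h) (t0 + k) - cm| <= e,
      p * h + e * `|h| < k -> `|F (s0 + h) (t0 + k) - cp| <= e,
      k < - ((`|p| + 1) * `|h|) ->
        `|F (s0 + h) (t0 + k) - F s0 (t0 + k) - dm * h| <= e * `|h| &
      (`|p| + 1) * `|h| < k ->
        `|F (s0 + h) (t0 + k) - F s0 (t0 + k) - dp * h| <= e * `|h|].

Let bF s : bounded_measurable (F s).
Proof. by split; [exact: mF | exists M]. Qed.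

(** The error is proportional to [b - a], so that it adds up without loss over adjacent intervals.
    The slope [D] may depend on [eta]. *)
Definition near_derivable (s0 eta a b : R) := exists D, exists2 d, 0 < d &
  forall h, `|h| < d ->
  `|itv_integral (F (s0 + h)) a b - itv_integral (F s0) a b - D * h| <=
    eta * (b - a) * `|h|.

Lemma near_derivable_cat s0 eta a b c : a <= b -> b <= c ->
  near_derivable s0 eta a b -> near_derivable s0 eta b c ->
  near_derivable s0 eta a c.
Proof.
move=> ab bc [D1 [d1 d10 h1]] [D2 [d2 d20 h2]].
exists (D1 + D2); exists (Num.min d1 d2); first by rewrite lt_min d10.
move=> h; rewrite lt_min => /andP[/h1 {}h1 /h2 {}h2].
rewrite !(itv_integral_cat (bF _) ab bc).
move: h1 h2; rewrite !ler_norml.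
do 4 move: (itv_integral _ _ _) => ?.
by move=> /andP[? ?] /andP[? ?]; apply/andP; split; lra.
Qed.

(** Around [t0] a window of half-width [(|p| + 1) * |h|], shrinking with [h], contains the displaced
    boundary. Inside it the jump moves by about [p * h] and contributes [p * (cm - cp) * h]; outside
    it the integrand has nearly linear increments with slopes [dm] and [dp]. *)
Lemma jump_near_derivable s0 t0 p cm cp dm dp (eta : R) : 0 < eta ->
  jump_at s0 t0 p cm cp dm dp ->
  exists2 r, 0 < r & forall a b, t0 - r < a -> a < t0 -> t0 < b -> b < t0 + r ->
    near_derivable s0 eta a b.
Proof.
move=> eta0 jF.
have M0 : 0 <= M by apply: le_trans (FM s0 t0).
have eta40 : 0 < eta / 4 by rewrite divr_gt0.
(* This tolerance is independent of [a] and [b], so its radius can be announced before them; it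
   serves outside the window. Inside the window a finer tolerance [e], depending on [b - a], is
   used. *)
have [d d0 dF] := jF _ eta40.
exists d => // a b ra a0 b0 rb.
exists (p * (cm - cp) + dm * (t0 - a) + dp * (b - t0)).
(* [e * C * |h|] is the total error inside the window: twice [2 * e * r] with [r = L * |h|], plus
   the contribution of the cone of half-width [e * |h|]. *)
pose L := `|p| + 1; pose C := 4 * L + 2 * M + `|cm| + `|cp|.
have L0 : 0 < L by rewrite /L ltr_wpDl.
have C0 : 0 < C by rewrite /C -!addrA ltr_wpDr ?mulr_gt0 ?addr_ge0 ?mulr_ge0.
have ba : 0 < b - a by rewrite subr_gt0 (lt_trans a0).
have ba0 : 0 < eta / 4 * (b - a) by rewrite mulr_gt0.
pose e := Num.min 1 (eta / 4 * (b - a) / C).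
have e0 : 0 < e by rewrite lt_min ltr01 divr_gt0.
have e1 : e <= 1 by rewrite ge_min lexx.
have eC : e * C <= eta / 4 * (b - a).
  by rewrite -ler_pdivlMr// ge_min lexx orbT.
have [d' d'0 d'F] := jF _ e0.
pose S := `|dm| + `|dp| + 1.
have S0 : 0 < S by rewrite /S ltr_wpDl// addr_ge0.
pose w := Num.min (Num.min d d') (Num.min (t0 - a) (b - t0)).
have w0 : 0 < w by rewrite /w !lt_min d0 d'0 !subr_gt0 a0 b0.
have [wd wd' wa wb] : [/\ w <= d, w <= d', w <= t0 - a & w <= b - t0].
  by rewrite /w; split; rewrite !ge_min lexx ?orbT.
clearbody w.
(* The three bounds in turn keep the window inside [[a, b]] and within the range of [d'F], keep
   [|h|] below [d] and [d'], and make the loss [(|dm| + |dp|) * r] at most [eta / 4 * (b - a)]. *)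
exists (Num.min (w / L) (Num.min w (eta / 4 * (b - a) / (S * L)))).
  by rewrite !lt_min w0 !divr_gt0// mulr_gt0.
move=> h; rewrite !lt_min => /and3P[hw1 hw hS].
have H0 : 0 <= `|h| by [].
have {}hw1 : L * `|h| < w by rewrite mulrC -ltr_pdivlMr.
have {}hS : S * (L * `|h|) <= eta / 4 * (b - a).
  by rewrite mulrA mulrC -ler_pdivlMr ?mulr_gt0// ltW.
have [hd hd'] := (lt_le_trans hw wd, lt_le_trans hw wd').
have [rta rbt] := (lt_le_trans hw1 wa, lt_le_trans hw1 wb).
have rd' := lt_le_trans hw1 wd'.
have phN : `|p * h| = `|p| * `|h| by rewrite normrM.
have ph : - (`|p| * `|h|) <= p * h <= `|p| * `|h| by rewrite -ler_norml phN.
have rE : L * `|h| = `|p| * `|h| + `|h| by rewrite /L mulrDl mul1r.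
have rho0 : 0 <= e * `|h| by rewrite mulr_ge0// ltW.
have rho1 : e * `|h| <= `|h| by rewrite ler_piMl.
have zd : `|0 : R| < d' by rewrite normr0.
have near_d' k : - (L * `|h|) < k -> k < L * `|h| -> `|k| < d'.
  by move=> k1 k2; rewrite (lt_trans _ rd')// ltr_norml k1.
set r := L * `|h| in rd' rta rbt rE hS near_d'.
set rho := e * `|h| in rho0 rho1.
have r0 : 0 <= r by rewrite rE addr_ge0// mulr_ge0.
have rq : - r <= p * h - rho by case/andP: ph; clear -rE rho1; lra.
have qr : p * h + rho <= r by case/andP: ph; clear -rE rho1; lra.
have ar : a <= t0 - r by clear -rta; lra.
have rb' : t0 + r <= b by clear -rbt; lra.
have rr : t0 - r <= t0 + r by clear -r0; lra.
(* Both integrals are compared with that of a step function, the one at [s0] having [q = rho = 0]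
   because the cone shrinks to its apex. The step integrals differ by exactly
   [p * (cm - cp) * h]. *)
have mid : `|itv_integral (F (s0 + h)) (t0 - r) (t0 + r) -
    itv_integral (F s0) (t0 - r) (t0 + r) - p * (cm - cp) * h| <=
    eta / 4 * (b - a) * `|h|.
  have Ih := @itv_integral_step _ _ M t0 (p * h) rho r cm cp e
    (bF (s0 + h)) (FM _) e0 rho0 rq qr.
  have {}Ih : `|itv_integral (F (s0 + h)) (t0 - r) (t0 + r) -
      (cm * (p * h + r) + cp * (r - p * h))| <=
      2 * e * r + (2 * M + `|cm| + `|cp|) * rho.
    apply: Ih => k k1 k2.
    - have kd : `|k| < d' by apply: near_d' => //; clear -k2 qr rho0; lra.
      by have [+ _ _ _] := d'F h k hd' kd; apply.
    - have kd : `|k| < d' by apply: near_d' => //; clear -k1 rq rho0; lra.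
      by have [_ + _ _] := d'F h k hd' kd; apply.
  have I0 : `|itv_integral (F s0) (t0 - r) (t0 + r) -
      (cm * (0 + r) + cp * (r - 0))| <=
      2 * e * r + (2 * M + `|cm| + `|cp|) * 0.
    apply: itv_integral_step => //; rewrite ?subr0 ?add0r ?oppr_le0//.
    - move=> k k1 k2.
      have kd : `|k| < d' by apply: near_d' => //; apply: lt_le_trans k2 _.
      have [+ _ _ _] := d'F 0 k zd kd.
      by rewrite addr0; apply; rewrite normr0 !mulr0 subr0.
    - move=> k k1 k2.
      have kd : `|k| < d' by apply: near_d' => //; rewrite (le_lt_trans _ k1)// oppr_le0.
      have [_ + _ _] := d'F 0 k zd kd.
      by rewrite addr0; apply; rewrite normr0 !mulr0 addr0.
  have := ler_wpM2r H0 eC; move: Ih I0; rewrite /C /rho /r; clear.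
  rewrite !ler_norml; do 2 move: (itv_integral _ _ _) => ?.
  by move: (`|h|) (`|cm|) (`|cp|) => H Cm Cp /andP[? ?] /andP[? ?] ?;
    apply/andP; split; lra.
have outer u v z : u <= v ->
    (forall t, u < t -> t < v ->
      `|F (s0 + h) t - F s0 t - z * h| <= eta / 4 * `|h|) ->
    `|itv_integral (F (s0 + h)) u v - itv_integral (F s0) u v -
      z * h * (v - u)| <= eta / 4 * `|h| * (v - u).
  move=> uv Fz; rewrite -itv_integralB//.
  by apply: itv_integral_near_cst => //; exact: bounded_measurableB.
rewrite !(itv_integral_cat (bF _) ar (le_trans rr rb')).
rewrite !(itv_integral_cat (bF _) rr rb').
apply: (sum_near_linear (r := r)) mid _ => //; [exact: ltW|by rewrite -subr_ge0 ltW| | |].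
- apply: outer => // t t1 t2.
  have td : `|t - t0| < d.
    by rewrite ltr_norml; apply/andP; split; clear -t1 t2 ra r0 d0; lra.
  have [_ _ + _] := dF h (t - t0) hd td.
  by rewrite (addrC t0) subrK; apply; rewrite -/L -/r; clear -t2; lra.
- apply: outer => // t t1 t2.
  have td : `|t - t0| < d.
    by rewrite ltr_norml; apply/andP; split; clear -t1 t2 rb r0 d0; lra.
  have [_ _ _] := dF h (t - t0) hd td.
  by rewrite (addrC t0) subrK; apply; rewrite -/L -/r; clear -t1; lra.
- by apply: le_trans hS; apply: ler_wpM2r => //; rewrite /S lerDl.
Qed.

End jump.

Lemma jump_line_integral (R : realType) (F : R -> R -> R) (M K s0 : R) :
  (forall s, measurable_fun [set: R] (F s)) ->
  (forall s t, `|F s t| <= M) ->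
  (forall s t, K < `|t| -> F s t = 0) ->
  (forall t0, exists p cm cp dm dp, jump_at F s0 t0 p cm cp dm dp) ->
  let I s := \int[@lebesgue_measure R]_t F s t in
  cvg ((fun h : R => h^-1 * (I (s0 + h) - I s0)) @ (0 : R)^').
Proof.
move=> mF FM F0 jF I.
have IE s a b : a < - `|K| -> `|K| < b -> I s = itv_integral (F s) a b.
  move=> aK Kb; rewrite /itv_integral Rintegral_mkcond.
  apply: eq_Rintegral => t _; rewrite /patch; case: ifPn => // tab.
  apply: F0; rewrite ltNge; apply: contra tab => tK.
  have {}tK : `|t| <= `|K| := le_trans tK (ler_norm _).
  rewrite inE/= in_itv/=; move: tK; rewrite ler_norml => /andP[t1 t2].
  by rewrite (le_trans (ltW aK) t1) (le_trans t2 (ltW Kb)).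
have K0 : 0 <= `|K| by [].
have key (eta : R) : 0 < eta -> exists D, exists2 d, 0 < d &
    forall h, `|h| < d -> `|I (s0 + h) - I s0 - D * h| <= eta * `|h|.
  (* [W] exceeds the length of every interval that [chain_across] can return, so an error of
     [eta / W] per unit length totals at most [eta]. The chained relation includes [a < b] because
     concatenation needs ordered ends. *)
  move=> eta0; pose W := 2 * `|K| + 2.
  have W0 : 0 < W by rewrite /W ltr_wpDl// mulr_ge0.
  have [a [b [/andP[aK1 aK] /andP[Kb Kb1] [ab [D [d d0 dP]]]]]] :
    exists a b, [/\ - `|K| - 1 < a < - `|K|, `|K| < b < `|K| + 1 &
      a < b /\ near_derivable F s0 (eta / W) a b].
    apply: chain_across => [a b c [ab Pab] [bc Pbc]|t|].
    - split; first exact: lt_trans bc.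
      exact: near_derivable_cat mF FM _ _ _ _ _ (ltW ab) (ltW bc) Pab Pbc.
    - have [p [cm [cp [dm [dp jt]]]]] := jF t.
      have [r r0 rP] := jump_near_derivable mF FM (divr_gt0 eta0 W0) jt.
      exists r => // a b ra at_ tb br; split; first exact: lt_trans tb.
      exact: rP.
    - by rewrite (le_trans _ K0)// oppr_le0.
  exists D, d => // h hd; rewrite !(IE _ a b)//.
  apply: le_trans (dP _ hd) _; apply: ler_wpM2r => //.
  rewrite -mulrAC ler_pdivrMr// ler_wpM2l ?(ltW eta0)// /W.
  by clear -aK1 Kb1; lra.
(* Each tolerance comes with its own [D], so there is no candidate limit; [D] serves as the centre
   of a ball, and completeness of the reals gives the limit. *)
have cF : cauchy ((fun h : R => h^-1 * (I (s0 + h) - I s0)) @ (0 : R)^').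
  apply: cauchy_exP => e e0.
  have e20 : 0 < e / 2 by rewrite divr_gt0.
  have [D [d d0 dP]] := key _ e20.
  exists D.
  change (\forall h \near (0 : R)^', ball D e (h^-1 * (I (s0 + h) - I s0))).
  near=> h.
  have h0 : h != 0 by near: h; exact: nbhs_dnbhs_neq.
  have nh0 : 0 < `|h| by rewrite normr_gt0.
  rewrite -ball_normE/= distrC -(ltr_pM2r nh0) -normrM mulrBl mulrAC mulVf// mul1r.
  apply: le_lt_trans (dP h _) _; last first.
    by rewrite ltr_pM2r// ltr_pdivrMr// mulr_natr mulr2n ltrDl.
  near: h; apply: dnbhs0_lt; exact: d0.
by apply/cauchy_cvgP.
Unshelve. all: by end_near.
Qed.

(** * Directional derivatives in the plane *)

Section directional_derivative.
Context {R : realType} {V : normedModType R}.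

Lemma is_derive_along (u : V -> R) (a x : V) (t d : R) :
  is_derive (a + t *: x) x u d -> is_derive t 1 (fun r => u (a + r *: x)) d.
Proof.
move=> [du <-].
have E : (fun h : R => h^-1 *: (((fun r => u (a + r *: x)) \o shift t) (h *: 1)
      - u (a + t *: x))) =
    (fun h : R => h^-1 *: ((u \o shift (a + t *: x)) (h *: x)
      - u (a + t *: x))).
  apply/funext => h /=; congr (_ *: (u _ - _)).
  by rewrite [h *: 1]mulr1 scalerDl addrCA.
by split; rewrite /derivable /derive E.
Qed.

(** By the mean value theorem the increment is [h] times a derivative at an intermediate point. The
    symmetric range of [t] covers both signs of [h]. *)
Lemma increment_near_linear (phi : R -> R) (d e h : R) :
  (forall t : R, `|t| <= `|h| -> exists d' : R,
     is_derive t 1 phi d' /\ `|d' - d| <= e) ->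
  `|phi h - phi 0 - d * h| <= e * `|h|.
Proof.
move=> dphi.
have drv (t : R) : `|t| <= `|h| -> is_derive t 1 phi ('D_1 phi t) /\
    `|'D_1 phi t - d| <= e.
  move=> th; have [d' [id' d'd]] := dphi t th.
  by rewrite derive_val.
have mvt a b : a <= b -> (forall t, t \in `[a, b] -> `|t| <= `|h|) ->
    exists2 c, `|c| <= `|h| & phi b - phi a = 'D_1 phi c * (b - a).
  move=> ab abh; have [] := @MVT_segment R phi ('D_1 phi) a b ab.
  - by move=> t tab; have [] := drv t (abh _ (subset_itv_oo_cc tab)).
  - apply: derivable_within_continuous => t /abh /drv [dt _].
    exact: ex_derive.
  - by move=> c /abh ch ->; exists c.
have key c : `|c| <= `|h| -> `|'D_1 phi c * h - d * h| <= e * `|h|.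
  by move=> ch; rewrite -mulrBl normrM ler_wpM2r//; have [] := drv c ch.
have [h0|h0] := leP 0 h.
- have [t|c ch] := mvt 0 h h0.
    by rewrite in_itv/= => /andP[t0 th]; rewrite !ger0_norm.
  by rewrite subr0 => ->; exact: key.
- have [t|c ch] := mvt h 0 (ltW h0).
    by rewrite in_itv/= => /andP[t0 th]; rewrite !ler0_norm ?lerN2// ltW.
  rewrite sub0r mulrN => E; have -> : phi h - phi 0 = 'D_1 phi c * h.
    by rewrite -[LHS]opprB E opprK.
  exact: key.
Qed.

(** Turns neighbourhoods into boxes in the coordinates along [x] and [v]; the [+ 1] in the radius
    avoids division by zero. *)
Lemma near_plane (y x v : V) (P : set V) : (\forall z \near y, P z) ->
  exists2 d : R, 0 < d &
    forall h k : R, `|h| < d -> `|k| < d -> P (y + k *: v + h *: x).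
Proof.
move=> /nbhs_ballP[e /= e0 eP].
have S0 : 0 < `|x| + `|v| + 1 by rewrite ltr_wpDl// addr_ge0.
exists (e / (`|x| + `|v| + 1)); first by rewrite divr_gt0.
move=> h k hd kd; apply: eP; rewrite -ball_normE/= opprD addrA opprD addrA.
rewrite subrr sub0r -opprD normrN.
apply: le_lt_trans (ler_normD _ _) _; rewrite !normrZ.
set d := e / _ in hd kd.
have -> : e = d * `|v| + d * `|x| + d.
  by rewrite -[X in _ + X]mulr1 -!mulrDr (addrC `|v|) /d divfK// gt_eqF.
rewrite ltr_pwDr ?divr_gt0//.
by rewrite lerD// ler_wpM2r// ltW.
Qed.

End directional_derivative.

(** The step [h *: x] is split into a vertical leg followed by a horizontal one. On each leg the
    mean value theorem applies, with a partial derivative close to its value at [y]. *)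
Lemma is_derive_partials (R : realType) (u h1 h2 : R * R -> R) (x y : R * R) :
  (\forall z \near y, is_derive (z : R * R) (1, 0) u (h1 z) /\
     is_derive z (0, 1) u (h2 z)) ->
  {for y, continuous h1} -> {for y, continuous h2} ->
  is_derive y x u (x.1 * h1 y + x.2 * h2 y).
Proof.
move=> du c1 c2; set D := _ + _.
pose e1 : R * R := (1, 0); pose e2 : R * R := (0, 1).
have lim : (fun h : R => h^-1 *: ((u \o shift y) (h *: x) - u y)) @ (0 : R)^'
    --> D.
  apply/cvgrPdist_le => /= e e0.
  pose e' := e / (`|x.1| + `|x.2| + 1).
  have S0 : 0 < `|x.1| + `|x.2| + 1 by rewrite ltr_wpDl// addr_ge0.
  have e'0 : 0 < e' by rewrite divr_gt0.
  have near1 : \forall z \near y, `|h1 z - h1 y| <= e'.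
    by have /cvgrPdist_le /(_ _ e'0) := c1; apply: filterS => z; rewrite distrC.
  have near2 : \forall z \near y, `|h2 z - h2 y| <= e'.
    by have /cvgrPdist_le /(_ _ e'0) := c2; apply: filterS => z; rewrite distrC.
  have [d d0 dP] := near_plane e1 e2
    (filterI du (filterI near1 near2)).
  near=> h.
  have h0 : h != 0 by near: h; exact: nbhs_dnbhs_neq.
  have nh0 : 0 < `|h| by rewrite normr_gt0.
  have hS : `|h| * (`|x.1| + `|x.2| + 1) < d.
    by rewrite -ltr_pdivlMr//; near: h; apply: dnbhs0_lt; rewrite divr_gt0.
  have hx1 : `|h * x.1| < d.
    rewrite normrM; apply: le_lt_trans hS; rewrite ler_pM2l//.
    by rewrite -addrA lerDl addr_ge0.
  have hx2 : `|h * x.2| < d.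
    rewrite normrM; apply: le_lt_trans hS; rewrite ler_pM2l//.
    by rewrite addrAC addrC lerDl addr_ge0.
  have z0 : `|0 : R| < d by rewrite normr0.
  have I1 := @increment_near_linear R (fun t => u (y + (h * x.2) *: e2 + t *: e1))
    (h1 y) e' (h * x.1).
  have {}I1 : `|u (y + (h * x.2) *: e2 + (h * x.1) *: e1) -
      u (y + (h * x.2) *: e2 + 0 *: e1) - h1 y * (h * x.1)| <=
      e' * `|h * x.1|.
    apply: I1 => t tx; have [[du1 _] [n1 _]] := dP t _ (le_lt_trans tx hx1) hx2.
    by eexists; split; [exact: is_derive_along du1 | exact: n1].
  have I2 : `|u (y + (h * x.2) *: e2) - u (y + 0 *: e2) -
      h2 y * (h * x.2)| <= e' * `|h * x.2|.
    apply: (@increment_near_linear R (fun t => u (y + t *: e2))) => t tx.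
    have := dP 0 _ z0 (le_lt_trans tx hx2).
    rewrite scale0r addr0 => -[[_ du2] [_ n2]].
    by eexists; split; [exact: is_derive_along du2 | exact: n2].
  move: I1 I2; rewrite !scale0r !addr0.
  have -> : y + (h * x.2) *: e2 + (h * x.1) *: e1 = h *: x + y.
    rewrite -addrA addrC; congr (_ + _).
    apply: injective_projections => /=.
      by rewrite [_ *: 0]mulr0 [_ *: 1]mulr1 add0r.
    by rewrite [_ *: 0]mulr0 [_ *: 1]mulr1 addr0.
  move=> I1 I2.
  rewrite -(ler_pM2l nh0) -normrM mulrBr [h * (_ *: _)]mulrA mulfV// mul1r distrC.
  have := lerD I1 I2; move/(le_trans (ler_normD _ _)).
  have -> : u (h *: x + y) - u (y + (h * x.2) *: e2) - h1 y * (h * x.1) +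
    (u (y + (h * x.2) *: e2) - u y - h2 y * (h * x.2)) =
    u (h *: x + y) - u y - h * D by rewrite /D; lra.
  move/le_trans; apply; rewrite -mulrDr !normrM -mulrDr mulrCA ler_pM2l//.
  by rewrite /e' mulrAC ler_pdivrMr// ler_pM2l// lerDl.
split; first by apply/cvg_ex; exists D.
exact: cvg_lim lim.
Unshelve. all: by end_near.
Qed.

(** * Cones free of boundary points and one-sided behaviour at the boundary *)

Section cone.
Context {R : realType}.
Implicit Types (A : set (R * R)) (x v y : R * R).

Lemma interior_along_path A (g : R -> R * R) : continuous g ->
  (forall t, t \in `[0, 1] -> ~ boundary A (g t)) -> A (g 0) ->
  interior A (g 1).
Proof.
move=> cg gA A0.
have i0 : `[0, 1]%classic (0 : R) by rewrite /= in_itv/= lexx ler01.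
have i1 : `[0, 1]%classic (1 : R) by rewrite /= in_itv/= lexx ler01.
have : [set g t | t in `[0, 1]] `<=` A^° \/
    [set g t | t in `[0, 1]] `<=` ~` closure A.
  apply: connected_subset.
  - split; apply/seteqP; split => // z [].
    + by move=> Az; apply; move: z Az; apply: closure_subset; exact: interior_subset.
    + move=> /= Az cz; have [w [Aw]] := cz _ (open_nbhs_nbhs (conj (@open_interior _ A) Az)).
      by move=> /interior_subset/subset_closure.
  - move=> _ /= [t t01 <-]; have := gA t t01; rewrite /boundary.
    by move=> /not_andP[|/contrapT]; [right|left].
  - apply: connected_continuous_connected; first exact: segment_connected.
    exact: continuous_subspaceT.
move=> [gi|gc]; first by apply: gi; exists 1.
by have := gc (g 0) (ex_intro2 _ _ 0 i0 erefl); have := subset_closure A0.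
Qed.

Variables (A : set (R * R)) (x v y0 : R * R) (p : R).

Let pt (h k : R) := y0 + k *: v + h *: x.

(** For [e >= 0] the region [p * h + e * |h| < k] is convex, and its part in the box contains no
    boundary point; hence the segment [g] between the two points avoids the boundary. *)
Lemma interior_in_cone (e d h k h' k' : R) : 0 <= e ->
  (forall h k, `|h| < d -> `|k| < d -> boundary A (pt h k) ->
     `|k - p * h| <= e * `|h|) ->
  `|h| < d -> `|k| < d -> p * h + e * `|h| < k ->
  `|h'| < d -> `|k'| < d -> p * h' + e * `|h'| < k' ->
  A (pt h k) -> interior A (pt h' k').
Proof.
move=> e0 bA hd kd hk hd' kd' hk' Ahk.
pose g t := pt ((1 - t) * h + t * h') ((1 - t) * k + t * k').
have -> : pt h' k' = g 1 by rewrite /g subrr !mul0r !mul1r !add0r.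
have nt (t a b : R) : 0 <= t -> t <= 1 ->
    `|(1 - t) * a + t * b| <= (1 - t) * `|a| + t * `|b|.
  move=> t0 t1; apply: le_trans (ler_normD _ _) _.
  by rewrite !normrM (ger0_norm t0) ger0_norm ?subr_ge0.
have conv (t a b c : R) : 0 <= t -> t <= 1 -> a < c -> b < c ->
    (1 - t) * a + t * b < c.
  move=> t0 t1 ac bc; pose m := Num.max a b.
  have am : a <= m by rewrite le_max lexx.
  have bm : b <= m by rewrite le_max lexx orbT.
  have mc : m < c by rewrite gt_max ac.
  apply: le_lt_trans mc; have -> : m = (1 - t) * m + t * m by rewrite -mulrDl subrK mul1r.
  by rewrite lerD// ler_wpM2l// subr_ge0.
apply: interior_along_path.
- move=> t; rewrite /g /pt; apply: cvgD; first apply: cvgD.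
  + exact: cvg_cst.
  + apply: cvgZr_tmp; apply: cvgD; apply: cvgM => //; try exact: cvg_cst.
    by apply: cvgB => //; exact: cvg_cst.
  + apply: cvgZr_tmp; apply: cvgD; apply: cvgM => //; try exact: cvg_cst.
    by apply: cvgB => //; exact: cvg_cst.
- move=> t; rewrite in_itv/= => /andP[t0 t1] /bA.
  move=> /(_ (le_lt_trans (nt _ _ _ t0 t1) (conv _ _ _ _ t0 t1 hd hd'))).
  move=> /(_ (le_lt_trans (nt _ _ _ t0 t1) (conv _ _ _ _ t0 t1 kd kd'))).
  apply/negP; rewrite -ltNge.
  have hk0 : p * h + e * `|h| - k < 0 by rewrite subr_lt0.
  have hk0' : p * h' + e * `|h'| - k' < 0 by rewrite subr_lt0.
  have := conv _ _ _ _ t0 t1 hk0 hk0'; have := ler_wpM2l e0 (nt _ h h' t0 t1).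
  set N := `|(1 - t) * h + t * h'|; move: (`|h|) (`|h'|) => H H'; clear.
  move=> ? ?; apply: lt_le_trans (ler_norm _); lra.
- by rewrite /g subr0 !mul1r !mul0r !addr0.
Qed.

End cone.

(** Designed for points [y0] on the boundary: [d] is the limit at [y0] of the derivatives along [x]
    taken at interior points. *)
Definition smooth_along (R : realType) (A : set (R * R)) (u : R * R -> R)
    (x y0 : R * R) :=
  exists d, forall e, 0 < e -> \forall y \near y0,
    (A y -> `|u y - u y0| <= e) /\
    (interior A y -> exists d', is_derive y x u d' /\ `|d' - d| <= e).

Section one_side.
Context {R : realType}.
Variables (A : set (R * R)) (u : R * R -> R) (x y0 : R * R).
Hypotheses (clA : closed A) (u0 : forall y, ~ A y -> u y = 0).
Hypothesis u_smooth : A y0 -> smooth_along A u x y0.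

(** The cone above [y0] lies either in the interior of [A], where the limits come from the
    smoothness of [u], or outside [A], where [u] vanishes and [c = d = 0]. *)
Lemma one_side (v : R * R) (p : R) :
  (forall e, 0 < e -> exists2 d, 0 < d & forall h k, `|h| < d -> `|k| < d ->
     boundary A (y0 + k *: v + h *: x) -> `|k - p * h| <= e * `|h|) ->
  exists c d, forall e, 0 < e -> exists2 r, 0 < r &
    forall h k, `|h| < r -> `|k| < r ->
    (p * h + e * `|h| < k -> `|u (y0 + k *: v + h *: x) - c| <= e) /\
    ((`|p| + 1) * `|h| < k ->
       `|u (y0 + k *: v + h *: x) - u (y0 + k *: v) - d * h| <= e * `|h|).
Proof.
move=> slope.
have slope1 e : 0 < e -> exists e' d, [/\ 0 < e', e' <= e, e' <= 1, 0 < d &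
    forall h k, `|h| < d -> `|k| < d ->
    boundary A (y0 + k *: v + h *: x) -> `|k - p * h| <= e' * `|h|].
  move=> e0; pose e' := Num.min e 1.
  have e'0 : 0 < e' by rewrite lt_min e0 ltr01.
  have [d d0 dP] := slope e' e'0.
  by exists e', d; split => //; rewrite ge_min lexx ?orbT.
(* Since [e' <= 1], the region [(|p| + 1) * |h| < k] lies in the cone; by [thin] it contains, with
   [(h, k)], the whole segment from [(0, k)], along which the derivative is integrated. *)
have wide (e' h k : R) : e' <= 1 -> (`|p| + 1) * `|h| < k ->
    p * h + e' * `|h| < k.
  move=> e1; apply: le_lt_trans; rewrite mulrDl; apply: lerD.
    by rewrite -normrM ler_norm.
  by rewrite ler_wpM2r.
have thin (t h k : R) : `|t| <= `|h| -> (`|p| + 1) * `|h| < k ->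
    (`|p| + 1) * `|t| < k.
  by move=> th; apply: le_lt_trans; rewrite ler_wpM2l// addr_ge0.
(* The side is decided on the axis [h = 0] of the cone, by whether [A] is met at arbitrarily small
   heights. *)
have [inA|outA] := pselect (forall d, 0 < d ->
    exists k, [/\ 0 < k, k < d & A (y0 + k *: v)]).
- have Ay0 : A y0.
    apply: clA => B /(near_plane x v)[d d0 dB].
    have [k [k0 kd Ak]] := inA d d0.
    exists (y0 + k *: v); split => //.
    rewrite -[y0 + _]addr0 -(scale0r x).
    by apply: dB; rewrite ?normr0// gtr0_norm.
  have [d dP] := u_smooth Ay0.
  exists (u y0), d => e e0.
  have [e' [r1 [e'0 e'e e'1 r10 r1P]]] := slope1 e e0.
  have [r2 r20 r2P] := near_plane x v (dP _ e0).
  exists (Num.min r1 r2); first by rewrite lt_min r10.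
  have inner h k : `|h| < Num.min r1 r2 -> `|k| < Num.min r1 r2 ->
      p * h + e' * `|h| < k -> interior A (y0 + k *: v + h *: x).
    rewrite !lt_min => /andP[h1 h2] /andP[k1 k2] hk.
    have [k0 [k00 k0r Ak0]] := inA r1 r10.
    apply: (interior_in_cone (ltW e'0) r1P _ _ _ h1 k1 hk (h := 0) (k := k0)).
    + by rewrite normr0.
    + by rewrite gtr0_norm.
    + by rewrite normr0 !mulr0 addr0.
    + by rewrite scale0r addr0.
  move=> h k hr kr; split=> hk.
  + have Ahk : interior A (y0 + k *: v + h *: x).
      apply: inner => //; apply: le_lt_trans hk.
      by rewrite lerD2l ler_wpM2r.
    move: hr kr; rewrite !lt_min => /andP[_ h2] /andP[_ k2].
    have [+ _] := r2P h k h2 k2; apply; exact: interior_subset.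
  + have := @increment_near_linear R (fun t => u (y0 + k *: v + t *: x)) d e h.
    rewrite scale0r addr0; apply => t th.
    have tr := le_lt_trans th hr.
    have Atk : interior A (y0 + k *: v + t *: x).
      by apply: inner => //; apply: wide => //; apply: thin hk.
    move: tr kr; rewrite !lt_min => /andP[_ t2] /andP[_ k2].
    have [_ /(_ Atk)[d' [ud' d'd]]] := r2P t k t2 k2.
    by exists d'; split => //; exact: is_derive_along ud'.
- have [r0 r00 r0P] : exists2 r0, 0 < r0 & forall k, 0 < k -> k < r0 ->
      ~ A (y0 + k *: v).
    apply: contrapT => nr; apply: outA => d d0; apply: contrapT => nk.
    apply: nr; exists d => // k k0 kd Ak; apply: nk; by exists k.
  exists 0, 0 => e e0.
  have [e' [r1 [e'0 e'e e'1 r10 r1P]]] := slope1 e e0.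
  exists r1 => //.
  (* One point of [A] in the cone would put all low points of the axis in [A], against [r0P]. *)
  have outer h k : `|h| < r1 -> `|k| < r1 -> p * h + e' * `|h| < k ->
      u (y0 + k *: v + h *: x) = 0.
    move=> hr kr hk; apply: u0 => Ahk.
    pose k0 := Num.min r0 r1 / 2.
    have m0 : 0 < Num.min r0 r1 by rewrite lt_min r00.
    have k00 : 0 < k0 by rewrite divr_gt0.
    have k0m : k0 < Num.min r0 r1.
      by rewrite ltr_pdivrMr// mulr_natr mulr2n ltrDl.
    move: k0m; rewrite lt_min => /andP[k0r k0r1].
    apply: (r0P k0) => //; apply: interior_subset.
    rewrite -[y0 + _]addr0 -(scale0r x).
    apply: (interior_in_cone (ltW e'0) r1P hr kr hk) => //.
    + by rewrite normr0.
    + by rewrite gtr0_norm.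
    + by rewrite normr0 !mulr0 addr0.
  move=> h k hr kr; split=> hk.
  + rewrite outer// ?subrr ?normr0 ?ltW//; apply: le_lt_trans hk.
    by rewrite lerD2l ler_wpM2r.
  + rewrite outer//; last exact: wide hk.
    have := outer 0 k; rewrite scale0r addr0 => ->; rewrite ?normr0//.
    * by rewrite mul0r !subr0 normr0 mulr_ge0// ltW.
    * by rewrite !mulr0 addr0; apply: le_lt_trans hk; rewrite mulr_ge0// addr_ge0.
Qed.

End one_side.

Section jump_of_section.
Context {R : realType}.
Variables (A : set (R * R)) (u : R * R -> R) (x : R * R) (s0 t0 : R).
Hypotheses (clA : closed A) (u0 : forall y, ~ A y -> u y = 0).
Let y0 := s0 *: x + t0 *: perp x.
Hypothesis u_smooth : A y0 -> smooth_along A u x y0.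
Variable p : R.
Hypothesis slope : forall e, 0 < e -> exists2 d, 0 < d &
  forall h k, `|h| < d -> `|k| < d ->
    boundary A (y0 + k *: perp x + h *: x) -> `|k - p * h| <= e * `|h|.

Lemma section_jump_at : exists cm cp dm dp,
  jump_at (fun s t => u (s *: x + t *: perp x)) s0 t0 p cm cp dm dp.
Proof.
have [cp [dp up]] := one_side clA u0 u_smooth slope.
(* The lower side is the upper side for the reversed axis [- perp x], which changes [p] into
   [- p]. *)
have slopeN e : 0 < e -> exists2 d, 0 < d &
    forall h k, `|h| < d -> `|k| < d ->
    boundary A (y0 + k *: (- perp x) + h *: x) -> `|k - (- p) * h| <= e * `|h|.
  move=> /slope[d d0 dP]; exists d => // h k hd kd.
  rewrite scalerN -scaleNr => /dP; rewrite normrN => /(_ hd kd).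
  by rewrite -normrN opprD !opprK mulNr opprK.
have [cm [dm lo]] := one_side clA u0 u_smooth slopeN.
exists cm, cp, dm, dp => e e0.
have [r1 r10 {}up] := up e e0; have [r2 r20 {}lo] := lo e e0.
exists (Num.min r1 r2); first by rewrite lt_min r10.
move=> h k; rewrite !lt_min => /andP[h1 h2] /andP[k1 k2].
have yE : (s0 + h) *: x + (t0 + k) *: perp x = y0 + k *: perp x + h *: x.
  by rewrite !scalerDl addrACA (addrC (h *: x)) addrA.
have yE0 : s0 *: x + (t0 + k) *: perp x = y0 + k *: perp x.
  by rewrite scalerDl addrA.
rewrite yE yE0; have [up1 up2] := up h k h1 k1.
have := lo h (- k) h2; rewrite normrN => /(_ k2).
rewrite scalerN scaleNr opprK normrN => -[lo1 lo2]; split => //.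
- by move=> hk; apply: lo1; rewrite ltrNr opprD mulNr opprK.
- by move=> hk; apply: lo2; rewrite ltrNr.
Qed.

End jump_of_section.

(** * Slope of the boundary from its normal *)

Section slope.
Context {R : realType}.
Variables (A : set (R * R)) (x : R * R).

Lemma closed_boundary : closed (boundary A).
Proof.
rewrite /boundary setDE; apply: closedI; first exact: closed_closure.
by apply: open_closedC; exact: open_interior.
Qed.

Lemma dotD (n y z : R * R) : dot n (y + z) = dot n y + dot n z.
Proof. by rewrite /dot/= !mulrDr addrACA. Qed.

Lemma dotZ (n y : R * R) (c : R) : dot n (c *: y) = c * dot n y.
Proof.
by rewrite /dot/= ![_ *: _]/(_ * _) mulrDr !(mulrCA c).
Qed.

Lemma orthogonal_perp (n : R * R) : unit_circle x -> dot n (perp x) = 0 ->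
  n = dot n x *: x.
Proof.
rewrite /unit_circle/= /dot/= => xx nx.
have n2 : n.2 * x.1 = n.1 * x.2.
  by move/eqP: nx; rewrite mulrN addrC subr_eq0 => /eqP.
have e1 : n.2 * x.1 * x.2 = n.1 * x.2 * x.2 by rewrite n2.
have e2 : n.2 * x.1 * x.1 = n.1 * x.2 * x.1 by rewrite n2.
apply: injective_projections => /=; rewrite -[LHS]mulr1 -xx.
  change (n.1 * (x.1 * x.1 + x.2 * x.2) = (n.1 * x.1 + n.2 * x.2) * x.1).
  by move: (n.1) (n.2) (x.1) (x.2) e1; clear => ? ? ? ? ?; lra.
change (n.2 * (x.1 * x.1 + x.2 * x.2) = (n.1 * x.1 + n.2 * x.2) * x.2).
by move: (n.1) (n.2) (x.1) (x.2) e2; clear => ? ? ? ? ?; lra.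
Qed.

(** With [a] and [b] the components of the normal along [x] and [perp x], the tangent line is
    [a * h + b * k = 0]. Here [b != 0], since otherwise the normal would be parallel to [x]; so the
    slope is [p = - a / b]. Off the boundary the condition is vacuous nearby. *)
Lemma boundary_slope (y : R * R) : unit_circle x ->
  ~ (corners A `|` normal_parallel_points x A) y ->
  exists p, forall e, 0 < e -> exists2 d, 0 < d &
  forall h k, `|h| < d -> `|k| < d ->
    boundary A (y + k *: perp x + h *: x) -> `|k - p * h| <= e * `|h|.
Proof.
move=> x1 /not_orP[nX nY].
have [bAy|nbAy] := pselect (boundary A y); last first.
  have := @open_nbhs_nbhs _ y (~` boundary A).
  move/(_ (conj (closed_openC closed_boundary) nbAy)).
  move=> /(near_plane x (perp x))[d d0 dP].
  by exists 0 => e e0; exists d => // h k hd kd /(dP h k hd kd).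
have [nu [nuP _]] : normal_continuous_at A y.
  by apply: contrapT => nc; apply: nX.
have ny := nbhs_singleton nuP bAy; have [_ tan _] := ny.
set n := nu y in ny tan.
pose a := dot n x; pose b := dot n (perp x).
have b0 : b != 0.
  apply/eqP => b0; apply: nY; split => //; exists n; split => //.
  by exists a; exact: orthogonal_perp.
have nb0 : 0 < `|b| by rewrite normr_gt0.
pose p := - a / b.
exists p => e e0.
pose S := `|x| + `|perp x| + 1.
have S0 : 0 < S by rewrite /S ltr_wpDl// addr_ge0.
have p0 : 0 < `|p| + 1 by rewrite ltr_wpDl.
(* The tangency error is at most [e' * S * (|k| + |h|)], with [|k| <= |k - p * h| + |p| * |h|]. The
   first bound absorbs the [|k - p * h|] part into half of the left side; the second makes the rest
   at most [e * |b| / 2 * |h|]. *)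
pose e' := Num.min (`|b| / 2 / S) (e * `|b| / 2 / (S * (`|p| + 1))).
have e'0 : 0 < e' by rewrite lt_min !divr_gt0 ?mulr_gt0.
have e'1 : e' * S <= `|b| / 2 by rewrite -ler_pdivlMr// ge_min lexx.
have e'2 : e' * S * (`|p| + 1) <= e * `|b| / 2.
  by rewrite -mulrA -ler_pdivlMr ?mulr_gt0// ge_min lexx orbT.
have [d d0 dP] := near_plane x (perp x) (tan _ e'0).
exists d => // h k hd kd /(dP h k hd kd).
have -> : y + k *: perp x + h *: x - y = k *: perp x + h *: x.
  by rewrite addrC -addrA addKr.
have -> : dot n (k *: perp x + h *: x) = b * (k - p * h).
  rewrite dotD !dotZ -/a -/b /p mulrBr mulrA mulrCA mulfV// mulr1.
  by rewrite mulNr opprK mulrC (mulrC h).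
rewrite normrM => I.
have nz : `|k *: perp x + h *: x| <= S * (`|k| + `|h|).
  apply: le_trans (ler_normD _ _) _; rewrite !normrZ mulrDr.
  rewrite (mulrC `|k|) (mulrC `|h|) lerD// ler_wpM2r// /S.
    by rewrite addrAC addrC lerDl addr_ge0.
  by rewrite -addrA lerDl addr_ge0.
have kph : `|k| <= `|k - p * h| + `|p| * `|h|.
  by rewrite -normrM; apply: le_trans (ler_normD _ _); rewrite subrK.
have eS0 : 0 <= e' * S by rewrite mulr_ge0 ?ltW.
have {}I := le_trans I (ler_wpM2l (ltW e'0) nz).
have I1 := ler_wpM2l eS0 kph.
have I2 := ler_wpM2r (normr_ge0 (k - p * h)) e'1.
have I3 := ler_wpM2r (normr_ge0 h) e'2.
rewrite -(ler_pM2l nb0).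
move: I I1 I2 I3; move: (`|k - p * h|) (`|k|) (`|h|) (`|p|) (`|b|) => z K H P B.
by clear => I I1 I2 I3; lra.
Qed.
End slope.

(** * From the source components to sections along lines *)

Section source.
Context {R : realType}.
Implicit Types (A K : set (R * R)) (u : R * R -> R) (x y : R * R).

(** Meant for [A] the whole support and [K] the component through [y0], which contains [A] only near
    [y0]. *)
Lemma smooth_along_subset A K u x y0 : (\forall y \near y0, A y -> K y) ->
  smooth_along K u x y0 -> smooth_along A u x y0.
Proof.
move=> AK [d dP]; exists d => e e0; have := nbhs_interior AK.
apply: filterS2 (filterI AK (dP e e0)) => y [AKy [uy duy]] nAK.
split=> [/AKy //|iA]; apply: duy.
by apply: filterS2 nAK iA => z; apply.
Qed.

(** The continuous extensions [h1], [h2] of the partial derivatives give the limit slope even when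
    [y0] is on the boundary. *)
Lemma C1_on_smooth_along K u x y0 : C1_on K u -> K y0 -> smooth_along K u x y0.
Proof.
move=> [cu [h1 [h2 [c1 c2 dh]]]] Ky0.
exists (x.1 * h1 y0 + x.2 * h2 y0) => e e0.
have wc (g : R * R -> R) : {within K, continuous g} -> g y @[y --> within K (nbhs y0)] --> g y0.
  by move=> cg; exact: ((subspace_continuousP K g).1 cg y0 Ky0).
have nu : \forall y \near within K (nbhs y0), `|u y0 - u y| <= e.
  by have /cvgrPdist_le := wc _ cu; apply.
have ch : x.1 * h1 y + x.2 * h2 y @[y --> within K (nbhs y0)] -->
    x.1 * h1 y0 + x.2 * h2 y0.
  by apply: cvgD; apply: cvgM; (try exact: cvg_cst); exact: wc.
have nh : \forall y \near within K (nbhs y0),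
    `|x.1 * h1 y0 + x.2 * h2 y0 - (x.1 * h1 y + x.2 * h2 y)| <= e.
  by have /cvgrPdist_le := ch; apply.
rewrite !near_withinE in nu nh.
apply: filterS2 nu nh => y uy hy; split=> [/uy|iK]; first by rewrite distrC.
exists (x.1 * h1 y + x.2 * h2 y); split.
  apply: is_derive_partials.
  - by move: (nbhs_interior iK); apply: filterS => z; exact: dh.
  - have := (subspace_continuousP K h1).1 c1 y (interior_subset iK).
    by rewrite (within_interior iK).
  - have := (subspace_continuousP K h2).1 c2 y (interior_subset iK).
    by rewrite (within_interior iK).
by rewrite distrC; apply: hy; exact: interior_subset.
Qed.

(** The other components are finitely many closed sets missing [y0], so a neighbourhood of [y0]
    avoids them all. *)
Lemma near_component (M : nat) (Om : 'I_M -> set (R * R)) m y0 :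
  (forall j, closed (Om j)) -> trivIset [set: 'I_M] Om -> Om m y0 ->
  \forall y \near y0, (\bigcup_(j in [set: 'I_M]) Om j) y -> Om m y.
Proof.
move=> clO /trivIsetP trO Omy.
have : \forall y \near y0, forall j, j != m -> ~ Om j y.
  apply: (@filter_forall _ _ (fun j => [set y | j != m -> ~ Om j y])
    (nbhs y0) _) => j; have [->|jm] := eqVneq j m.
    by apply: nearW => y /eqP.
  have nO : (~` Om j) y0.
    by move=> Oj; have := trO j m I I jm; rewrite -subset0 => /(_ y0); apply.
  have := open_nbhs_nbhs (conj (closed_openC (clO j)) nO).
  by apply: filterS => y + _.
apply: filterS => y ny [j _ Oj]; have [<-//|jm] := eqVneq j m.
by have := ny j jm.
Qed.

Lemma compact_norm_bound (V : normedModType R) (B : set V) : compact B ->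
  exists2 M : R, 0 <= M & forall y : V, B y -> `|y| <= M.
Proof.
move=> /compact_bounded[M [_ MP]]; exists (`|M| + 1); first exact: addr_ge0.
move=> y; apply: MP; apply: le_lt_trans (ler_norm M) _.
by rewrite ltrDl.
Qed.

Section strip.
Variables (A : set (R * R)) (u : R * R -> R) (x : R * R).
Hypotheses (cA : compact A) (u0 : forall y, ~ A y -> u y = 0)
  (u_smooth : forall y, A y -> smooth_along A u x y) (x1 : unit_circle x).

Lemma smooth_along_continuous : {within A, continuous u}.
Proof.
apply/subspace_continuousP => y Ay; apply/cvgrPdist_le => e e0.
have [d dP] := u_smooth Ay.
rewrite near_withinE; apply: filterS (dP e e0) => z [+ _] Az.
by rewrite distrC; apply.
Qed.

Lemma section_bounded : exists M, forall y, `|u y| <= M.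
Proof.
have cuA := continuous_compact smooth_along_continuous cA.
have [M M0 MP] := compact_norm_bound cuA.
exists M => y; have [Ay|/u0 ->] := pselect (A y); last by rewrite normr0.
by apply: MP; exists y.
Qed.

Lemma section_support : exists L : R, forall s t, L < `|t| ->
  u (s *: x + t *: perp x) = 0.
Proof.
have [L L0 LP] := compact_norm_bound cA.
exists ((`|x.2| + `|x.1|) * L) => s t.
rewrite ltNge => /negP Lt; apply: u0 => /LP yL; apply: Lt.
have -> : t = dot (perp x) (s *: x + t *: perp x).
  rewrite dotD !dotZ; move: x1; rewrite /unit_circle/= /dot/= => xx.
  by have := congr1 ( *%R t) xx; move: (x.1) (x.2) => ? ? ?; lra.
rewrite /dot; set y := _ + _ in yL *.
apply: le_trans (ler_normD _ _) _; rewrite !normrM mulrDl.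
have y1 : `|y.1| <= L by apply: le_trans yL; rewrite prod_normE le_max lexx.
have y2 : `|y.2| <= L by apply: le_trans yL; rewrite prod_normE le_max lexx orbT.
by rewrite lerD// ?normrN ler_wpM2l.
Qed.

(** The section is continuous on the closed preimage [E] of [A] and zero off it. *)
Lemma section_measurable s :
  measurable_fun [set: R] (fun t => u (s *: x + t *: perp x)).
Proof.
pose g t := s *: x + t *: perp x.
have cg : continuous g.
  move=> t; apply: cvgD; first exact: cvg_cst.
  by apply: cvgZr_tmp; exact: cvg_id.
pose E := g @^-1` A.
have clE : closed E.
  exact: (continuous_closedP g).1 cg _ (compact_closed (@norm_hausdorff _ _) cA).
have mE : measurable E by exact: closed_measurable.
rewrite -(setUv E); apply/measurable_funU => //; first exact: measurableC.
split.
  apply: subspace_continuous_measurable_fun => //.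
  apply/subspace_continuousP => t Et.
  apply/cvgrPdist_le => e e0; have [d dP] := u_smooth Et.
  have ng : \forall r \near t, A (g r) -> `|u (g r) - u (g t)| <= e.
    have nu : nbhs (g t) [set y | A y -> `|u y - u (g t)| <= e].
      by apply: filterS (dP e e0) => y [].
    exact: (cg t _ nu).
  by rewrite near_withinE; apply: filterS ng => r + Er; rewrite distrC; apply.
have z0 : {in ~` E, (cst 0 : R -> R) =1 (fun t => u (g t))}.
  by move=> t; rewrite inE => nE; rewrite u0.
by apply: (eq_measurable_fun _ z0); exact: measurable_cst.
Qed.

(** Every point of the line has a boundary slope, hence the section has a jump in the sense of
    [jump_at] at every height. *)
Lemma section_integral_derivable s0 :
  ~ (exists y, line x s0 y /\ (corners A `|` normal_parallel_points x A) y) ->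
  let I s := \int[@lebesgue_measure R]_t u (s *: x + t *: perp x) in
  cvg ((fun h : R => h^-1 * (I (s0 + h) - I s0)) @ (0 : R)^').
Proof.
move=> nXY.
have [M uM] := section_bounded; have [L uL] := section_support.
have clA : closed A := compact_closed (@norm_hausdorff _ _) cA.
apply: (jump_line_integral (M := M) (K := L)) => //.
  exact: section_measurable.
move=> t0; set y0 := s0 *: x + t0 *: perp x.
have ly0 : line x s0 y0.
  rewrite /line/= dotD !dotZ; move: x1; rewrite /unit_circle/= => ->.
  have -> : dot x (perp x) = 0 by rewrite /dot /= mulrN mulrC addNr.
  by rewrite mulr0 addr0 mulr1.
have [p pP] : exists p, forall e, 0 < e -> exists2 d, 0 < d &
    forall h k, `|h| < d -> `|k| < d ->
    boundary A (y0 + k *: perp x + h *: x) -> `|k - p * h| <= e * `|h|.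
  by apply: boundary_slope => // yXY; apply: nXY; exists y0.
have [cm [cp [dm [dp j]]]] :=
  section_jump_at clA u0 (fun Ay => u_smooth Ay) pP.
by exists p, cm, cp, dm, dp.
Qed.

End strip.
End source.

(** * Complex values and conclusion *)

Lemma cvg_complex (R : realType) (T : Type) (F : set_system T) (a b : T -> R) :
  Filter F -> cvg (a @ F) -> cvg (b @ F) ->
  cvg ((fun t => a t +i* b t : R[i]^o) @ F).
Proof.
move=> FF /cvg_ex[la ca] /cvg_ex[lb cb]; apply/cvg_ex; exists (la +i* lb).
(* The radius [e] is a positive element of [R[i]], so its imaginary part is zero and its real part
   is positive. *)
apply/cvgrPdist_lt => e; rewrite ltcE/= => /andP[/eqP e2 e1].
have e10 : 0 < complex.Re e / 2 by rewrite divr_gt0.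
move/cvgrPdist_lt : ca => /(_ _ e10) ca; move/cvgrPdist_lt : cb => /(_ _ e10).
apply: filterS2 ca => t at_ bt.
have -> : (la +i* lb : R[i]) - (a t +i* b t) =
    (la - a t)%:C + (0 +i* 1) * (lb - b t)%:C.
  by apply/eqP; rewrite eq_complex /= !(mul0r, mul1r, mulr0, addr0, subr0, add0r) !eqxx.
apply: le_lt_trans (ler_normD _ _) _.
rewrite normrM !normc_def /= !(expr0n, expr1n) /= !addr0 add0r sqrtr1 mul1r.
rewrite !sqrtr_sqr -rmorphD ltcE /= e2 eqxx /=.
by rewrite [ltRHS]splitr ltrD.
Qed.

Theorem lemma2p2 (R : realType) (f : R * R -> R[i]) (Omega : set (R * R))
  (supp_f : Omega = supp f) (compact_Omega : compact Omega)
  (source_f : source_assumption f Omega)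
  (x : R * R) (x_unit : unit_circle x) (s0 : R)
  (not_derivable : ~ complex_derivable (line_integral f x) s0) :
  (line x s0 `&` (corners Omega `|` normal_parallel_points x Omega)) !=set0.
Proof.
apply: contrapT => nXY; apply: not_derivable.
have f0 y : ~ Omega y -> f y = 0.
  move=> Oy; apply/eqP/negPn/negP => fy; apply: Oy; rewrite supp_f.
  exact: subset_closure.
have [[M [Om [OmE trO hOm fC1]]] _ _] := source_f.
have clO m : closed (Om m).
  by have [cO _ _ _ _] := hOm m; exact: compact_closed (@norm_hausdorff _ _) cO.
have smooth (u : R * R -> R) : (forall m, C1_on (Om m) u) ->
    forall y, Omega y -> smooth_along Omega u x y.
  move=> uC1 y; rewrite OmE => -[m _ Omy].
  apply: smooth_along_subset (C1_on_smooth_along x (uC1 m) Omy).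
  exact: near_component.
pose I (u : R * R -> R) s :=
  \int[@lebesgue_measure R]_t u (s *: x + t *: perp x).
pose q u (h : R) := h^-1 * (I u (s0 + h) - I u s0).
have cq (u : R * R -> R) : (forall y, ~ Omega y -> u y = 0) ->
    (forall m, C1_on (Om m) u) -> cvg (q u @ (0 : R)^').
  move=> u0 uC1; apply: (section_integral_derivable compact_Omega) => //.
  exact: smooth.
pose fr y := complex.Re (f y); pose fi y := complex.Im (f y).
have cfr : cvg (q fr @ (0 : R)^').
  by apply: cq => [y /f0|m]; [rewrite /fr => -> | exact: (fC1 m).1].
have cfi : cvg (q fi @ (0 : R)^').
  by apply: cq => [y /f0|m]; [rewrite /fi => -> | exact: (fC1 m).2].
(* As [h] is real, the complex quotient splits into the quotients of the real and imaginary
   parts. *)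
have qE : (fun h : R => (h%:C)^-1 *
      (line_integral f x (s0 + h) - line_integral f x s0) : R[i]^o) =
    (fun h => q fr h +i* q fi h : R[i]^o).
  apply/funext => h; rewrite /line_integral /cRintegral -fmorphV.
  by apply/eqP; rewrite eq_complex /= !mul0r subr0 addr0 !eqxx.
by rewrite /complex_derivable qE; exact: cvg_complex cfr cfi.
Qed.
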